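(* $$\int_0^{\infty} e^{-x^2}\cosh(x)\,dx = \frac{\sqrt{\pi}}{2}\,e^{1/4}.$$ *)

(* Defs.v *)
From HB Require Import structures.
From mathcomp Require Import all_boot all_order all_algebra.
From mathcomp Require Import all_classical all_reals all_analysis.

Set Implicit Arguments.
Unset Strict Implicit.
Unset Printing Implicit Defensive.
Import Order.TTheory GRing.Theory Num.Theory.
Local Open Scope ring_scope.

Definition cosh (R : realType) (x : R) : R := (expR x + expR (- x)) / 2.

(* Main.v *)
(* The integrand is even, so the integral is half of the integral over the whole
   line. Completing the square, e^(-x^2) cosh x is e^(1/4)/2 times the sum of two
   translates of the Gaussian, each of total mass sqrt pi. *)
Require Import Defs.
From HB Require Import structures.
From mathcomp Require Import all_boot all_order all_algebra.
From mathcomp Require Import all_classical all_reals all_analysis.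
From mathcomp Require Import ring measurable_realfun.

Set Implicit Arguments.
Unset Strict Implicit.
Unset Printing Implicit Defensive.
Import Order.TTheory GRing.Theory Num.Theory.
Import numFieldNormedType.Exports.
Local Open Scope classical_set_scope.
Local Open Scope ring_scope.

(** Substitution along the translation [F], an increasing map with derivative 1 and infinite limits
    at both ends. *)
Lemma integralT_gauss_shift (R : realType) (m : R) :
  (\int[lebesgue_measure]_x (gauss_fun (x + m))%:E = (Num.sqrt pi)%:E)%E.
Proof.
pose F : R -> R := fun x => x + m.
have F'E : F^`()%classic = cst 1.
  by apply/funext => x; rewrite /F derive1E deriveD// derive_id derive_cst addr0.
(* The value [Num.sqrt pi] is turned back into the unshifted integral, and the substitution acts on
   that side. *)
rewrite -integralT_gauss (@increasing_ge0_integration_by_substitutionT _ F gauss_fun).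
- by apply: eq_integral => x _; rewrite F'E !fctE/= mulr1.
- by move=> x y xy; rewrite /F ltrD2r.
- by rewrite F'E => x; exact: cvg_cst.
- by rewrite F'E; exact: is_cvg_cst.
- by rewrite F'E; exact: is_cvg_cst.
- by move=> x; exact: derivableD.
- exact: cvg_addrr_Ny.
- exact: cvg_addrr.
- exact: continuous_gauss_fun.
- by move=> x; exact: gauss_fun_ge0.
Qed.

(** Uses [- x^2 + x = 1/4 - (x - 1/2)^2] and its mirror image under [x -> - x]. *)
Lemma gauss_cosh (R : realType) (x : R) :
  expR (- (x ^+ 2)) * cosh x =
  expR (1 / 4) / 2 * (gauss_fun (x - 2^-1) + gauss_fun (x + 2^-1)).
Proof.
rewrite /cosh /gauss_fun mulrA mulrDr -!expRD mulrAC mulrDr -!expRD.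
by congr ((expR _ + expR _) / 2); field.
Qed.

Lemma continuous_gauss_shift (R : realType) (m : R) :
  continuous (fun x : R => gauss_fun (x + m)).
Proof.
move=> x; apply: continuous_comp; last exact: continuous_gauss_fun.
by apply: cvgD; [exact: cvg_id|exact: cvg_cst].
Qed.

(* MathComp-Analysis, over an arbitrary [R : realType]; Lebesgue integral. *)
Theorem theorem4p5 (R : realType) :
  (\int[@lebesgue_measure R]_(x in `[0%R, +oo[) (expR (- (x ^+ 2)) * cosh x)%:E
   = (Num.sqrt pi / 2 * expR (1 / 4))%:E)%E.
Proof.
(* Continuity, nonnegativity and evenness are the hypotheses of [ge0_symfun_integralT]. *)
have cf : continuous (fun x : R => expR (- (x ^+ 2)) * cosh x).
  under eq_fun do rewrite gauss_cosh.
  move=> x; apply: cvgM; first exact: cvg_cst.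
  by apply: cvgD; exact: continuous_gauss_shift.
have f0 (x : R) : 0 <= expR (- (x ^+ 2)) * cosh x.
  by rewrite mulr_ge0 ?expR_ge0// divr_ge0// addr_ge0 ?expR_ge0.
have f_even : (fun x : R => expR (- (x ^+ 2)) * cosh x) =1
    (fun x : R => expR (- (x ^+ 2)) * cosh x) \o -%R.
  by move=> x /=; rewrite /cosh sqrrN opprK [expR (- x) + _]addrC.
have mg (m : R) := continuous_measurable_fun (@continuous_gauss_shift R m).
have totalE : (\int[@lebesgue_measure R]_x (expR (- (x ^+ 2)) * cosh x)%:E
    = (expR (1 / 4) * Num.sqrt pi)%:E)%E.
  under eq_integral do rewrite gauss_cosh EFinM EFinD.
  (* For nonnegative functions, linearity asks only for measurability, so integrability is never
     proved. *)
  rewrite ge0_integralZl//=; last 2 first.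
  - by apply: emeasurable_funD; apply/measurable_EFinP; exact: mg.
  - by move=> x _; rewrite adde_ge0// lee_fin gauss_fun_ge0.
  rewrite ge0_integralD//=; last 4 first.
  - by move=> x _; rewrite lee_fin gauss_fun_ge0.
  - by apply/measurable_EFinP; exact: mg.
  - by move=> x _; rewrite lee_fin gauss_fun_ge0.
  - by apply/measurable_EFinP; exact: mg.
  by rewrite !integralT_gauss_shift -EFinD -EFinM; congr EFin; field.
have := totalE; rewrite (ge0_symfun_integralT f0 cf f_even).
have -> : [set x : R | 0 <= x] = `[0, +oo[%classic.
  by apply/seteqP; split => x /=; rewrite in_itv/= andbT.
(* By evenness the total is twice the half-line integral. That integral is an extended real not yet
   known to be finite, so the 2 is removed by multiplying both sides by [2^-1]. *)
move=> /(congr1 (fun y => 2^-1%:E * y)%E).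
rewrite muleA -EFinM mulVf// mul1e => ->.
by rewrite -EFinM; congr EFin; field.
Qed.
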